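(* The class $\mathfrak{F}_2$ of sub-normal frames determines $\mathrm{ILM}$, and the class $\mathfrak{F}_2'$ of sub-normal identity frames determines $\mathrm{ILM}$-$\vee$; that is, for every formula $\alpha\in F$: $\vdash_{\mathrm{ILM}}\alpha$ if and only if $\mathfrak{F}_2\vDash\alpha$, and $\vdash_{\mathrm{ILM}\text{-}\vee}\alpha$ if and only if $\mathfrak{F}_2'\vDash\alpha$.
   Context: The set $F$ of formulas of $\mathrm{ILM}$ is built from propositional variables and constants $\top,\bot$ with $\wedge,\vee,\rightarrow,\neg,\sim$; $\alpha\leftrightarrow\beta$ abbreviates $(\alpha\rightarrow\beta)\wedge(\beta\rightarrow\alpha)$. Axiom schemes of $\mathrm{ILM}$: (A1) $\alpha\rightarrow(\beta\rightarrow\alpha)$; (A2) $(\alpha\rightarrow(\beta\rightarrow\gamma))\rightarrow((\alpha\rightarrow\beta)\rightarrow(\alpha\rightarrow\gamma))$; (A3) $\alpha\rightarrow(\alpha\vee\beta)$, $\beta\rightarrow(\alpha\vee\beta)$; (A4) $(\alpha\rightarrow\gamma)\rightarrow((\beta\rightarrow\gamma)\rightarrow((\alpha\vee\beta)\rightarrow\gamma))$; (A5) $(\alpha\wedge\beta)\rightarrow\alpha$, $(\alpha\wedge\beta)\rightarrow\beta$; (A6) $(\alpha\rightarrow\beta)\rightarrow((\alpha\rightarrow\gamma)\rightarrow(\alpha\rightarrow(\beta\wedge\gamma)))$; (A7) $\alpha\rightarrow\top$; (A8) $\bot\rightarrow\alpha$; (A9) $(\alpha\rightarrow\beta)\rightarrow((\alpha\rightarrow\neg\beta)\rightarrow\neg\alpha)$;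 (A10) $\neg\alpha\rightarrow(\alpha\rightarrow\beta)$; (A11) $\sim\alpha\leftrightarrow(\alpha\rightarrow\neg\neg\sim\top)$. Modus ponens is the only rule. $\mathrm{ILM}$-$\vee$ is $\mathrm{ILM}$ plus the axiom scheme $\alpha\vee\sim\alpha$. A sub-normal frame is $(W,\leq,Y_0)$ with $(W,\leq)$ a nonempty poset and $Y_0\subseteq W$ an upset such that for all $x\in W$: if for every $y\geq x$ there is $z\geq y$ with $z\in Y_0$, then $x\in Y_0$. It is a sub-normal identity frame if moreover for all $x,y\in W\setminus Y_0$, $x\leq y$ implies $y\leq x$. A valuation assigns an upset of $W$ to each propositional variable. Truth: variables via $v$; $\top$ everywhere, $\bot$ nowhere; $\wedge,\vee$ pointwise; $x\vDash\alpha\rightarrow\beta$ iff for all $y\geq x$, $y\vDash\alpha$ implies $y\vDash\beta$; $x\vDash\neg\alpha$ iff for all $y\geq x$, $y\nvDash\alpha$; $x\vDash\sim\alpha$ iff for all $y\geq x$, $y\vDash\alpha$ implies $y\in Y_0$. For a class $\mathfrak{F}$ of frames, $\mathfrak{F}\vDash\alpha$ means $\alpha$ is true at every point under every valuation on every frame in $\mathfrak{F}$. *)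

(* Defs.v *)
From Stdlib Require Import Relations.Relation_Definitions.

Set Implicit Arguments.

Declare Scope ilm_scope.
Delimit Scope ilm_scope with ilm.

(** [V] is the set of propositional variables, left arbitrary. The two
    negations [Neg] and [Sim] and both constants are primitive. *)
Inductive formula (V : Type) : Type :=
| Var (p : V)
| Top
| Bot
| And (a b : formula V)
| Or (a b : formula V)
| Imp (a b : formula V)
| Neg (a : formula V)
| Sim (a : formula V).

Arguments Top {V}.
Arguments Bot {V}.
Bind Scope ilm_scope with formula.

Notation "⊤" := Top (at level 0) : ilm_scope.
Notation "⊥" := Bot (at level 0) : ilm_scope.
Notation "¬ a" := (Neg a) (at level 35, right associativity) : ilm_scope.
Notation "∼ a" := (Sim a) (at level 35, right associativity) : ilm_scope.
Notation "a ∧ b" := (And a b) (at level 40, left associativity) : ilm_scope.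
Notation "a ∨ b" := (Or a b) (at level 50, left associativity) : ilm_scope.
Notation "a ⇒ b" := (Imp a b) (at level 55, right associativity) : ilm_scope.

Definition Iff (V : Type) (a b : formula V) : formula V :=
  ((a ⇒ b) ∧ (b ⇒ a))%ilm.

Notation "a ⇔ b" := (Iff a b) (at level 60, no associativity) : ilm_scope.

Local Open Scope ilm_scope.

Inductive ILM_axiom (V : Type) : formula V -> Prop :=
| A1 a b : ILM_axiom (a ⇒ (b ⇒ a))
| A2 a b c : ILM_axiom ((a ⇒ (b ⇒ c)) ⇒ ((a ⇒ b) ⇒ (a ⇒ c)))
| A3l a b : ILM_axiom (a ⇒ (a ∨ b))
| A3r a b : ILM_axiom (b ⇒ (a ∨ b))
| A4 a b c : ILM_axiom ((a ⇒ c) ⇒ ((b ⇒ c) ⇒ ((a ∨ b) ⇒ c)))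
| A5l a b : ILM_axiom ((a ∧ b) ⇒ a)
| A5r a b : ILM_axiom ((a ∧ b) ⇒ b)
| A6 a b c : ILM_axiom ((a ⇒ b) ⇒ ((a ⇒ c) ⇒ (a ⇒ (b ∧ c))))
| A7 a : ILM_axiom (a ⇒ ⊤)
| A8 a : ILM_axiom (⊥ ⇒ a)
| A9 a b : ILM_axiom ((a ⇒ b) ⇒ ((a ⇒ ¬ b) ⇒ ¬ a))
| A10 a b : ILM_axiom (¬ a ⇒ (a ⇒ b))
| A11 a : ILM_axiom (∼ a ⇔ (a ⇒ ¬ ¬ ∼ ⊤)).

Inductive ILMv_axiom (V : Type) : formula V -> Prop :=
| ILMv_ILM a : ILM_axiom a -> ILMv_axiom a
| ILMv_em a : ILMv_axiom (a ∨ ∼ a).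

Inductive derivable (V : Type) (Ax : formula V -> Prop) : formula V -> Prop :=
| D_ax a : Ax a -> derivable Ax a
| D_mp a b : derivable Ax (a ⇒ b) -> derivable Ax a -> derivable Ax b.

Definition ILM_provable (V : Type) (a : formula V) : Prop :=
  derivable (@ILM_axiom V) a.

Definition ILMv_provable (V : Type) (a : formula V) : Prop :=
  derivable (@ILMv_axiom V) a.

Record frame : Type := Frame {
  world : Type;
  le : relation world;
  Y0 : world -> Prop
}.

Definition upset (F : frame) (U : world F -> Prop) : Prop :=
  forall x y : world F, le F x y -> U x -> U y.

Record sub_normal_frame (F : frame) : Prop := {
  sn_nonempty : inhabited (world F);
  sn_order : order (world F) (le F);
  sn_upset : upset F (Y0 F);
  sn_regular : forall x : world F,
    (forall y, le F x y -> exists z, le F y z /\ Y0 F z) -> Y0 F x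
}.

Record sub_normal_identity_frame (F : frame) : Prop := {
  sni_sub_normal : sub_normal_frame F;
  sni_identity : forall x y : world F,
    ~ Y0 F x -> ~ Y0 F y -> le F x y -> le F y x
}.

Definition valuation (V : Type) (F : frame) (v : V -> world F -> Prop) : Prop :=
  forall p : V, upset F (v p).

Fixpoint truth (V : Type) (F : frame) (v : V -> world F -> Prop)
    (x : world F) (a : formula V) : Prop :=
  match a with
  | Var p => v p x
  | Top => True
  | Bot => False
  | And a b => truth F v x a /\ truth F v x b
  | Or a b => truth F v x a \/ truth F v x b
  | Imp a b => forall y, le F x y -> truth F v y a -> truth F v y b
  | Neg a => forall y, le F x y -> ~ truth F v y a
  | Sim a => forall y, le F x y -> truth F v y a -> Y0 F y
  end.

Definition class_valid (C : frame -> Prop) (V : Type) (a : formula V) : Prop :=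
  forall F : frame, C F ->
  forall v : V -> world F -> Prop, valuation F v ->
  forall x : world F, truth F v x a.

(* Main.v *)
(** Soundness is a direct check; [A11] holds because, by regularity, [Y0] is
    exactly the truth set of [¬¬∼⊤].  Completeness uses the canonical frame:
    its worlds are the consistent prime theories ordered by inclusion, and
    [Y0] consists of those containing [¬¬∼⊤].  In the presence of [α ∨ ∼α],
    if [x ⊆ y] both lie outside [Y0] and [α ∈ y], then [∼α ∈ x] would put
    [¬¬∼⊤] into [y]; hence [α ∈ x], which is the identity condition. *)

From Stdlib Require Import Relation_Definitions Classical FunctionalExtensionality PropExtensionality.
From mathcomp Require classical_sets.
Require Import Defs.

Local Open Scope ilm_scope.

Arguments derivable {V} Ax _.
Arguments truth {V} F v x a.

(** * Soundness over a fixed sub-normal frame *)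

Section Soundness.

Variable V : Type.
Variable F : frame.
Hypothesis HF : sub_normal_frame F.

Lemma le_refl (x : world F) : le F x x.
Proof. exact (ord_refl _ _ (sn_order HF) x). Qed.

Lemma le_trans (x y z : world F) : le F x y -> le F y z -> le F x z.
Proof. exact (ord_trans _ _ (sn_order HF) x y z). Qed.

Variable v : V -> world F -> Prop.
Hypothesis Hv : valuation F v.

Lemma truth_upset (a : formula V) (x y : world F) :
  le F x y -> truth F v x a -> truth F v y a.
Proof.
revert x y; induction a as [p| | |a IHa b IHb|a IHa b IHb|a IHa b IHb|a IHa|a IHa];
  simpl; intros x y Hxy H; eauto using le_trans.
- exact (Hv p x y Hxy H).
- destruct H; eauto.
- destruct H; eauto.
Qed.

(** As [Y0] is an upset, [∼ ⊤] is true exactly on [Y0]; its double negation then says that [Y0] is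
    dense above [x], which is the premise of regularity. *)
Lemma truth_notnot_sim_top (x : world F) :
  truth F v x (¬ ¬ ∼ ⊤) <-> Y0 F x.
Proof.
simpl; split.
- intros H; apply (sn_regular HF); intros y Hxy.
  apply NNPP; intros Hn; apply (H y Hxy); intros z Hyz Hz.
  apply Hn; exists z; split; [assumption|].
  exact (Hz z (le_refl z) I).
- intros Hx y Hxy Hn; apply (Hn y (le_refl y)); intros z Hyz _.
  exact (sn_upset HF x z (le_trans _ _ _ Hxy Hyz) Hx).
Qed.

Lemma ILM_axiom_sound (a : formula V) :
  ILM_axiom a -> forall x : world F, truth F v x a.
Proof.
intros H x; pose proof le_refl as R; pose proof le_trans as T.
destruct H as [a b|a b c|a b|a b|a b c|a b|a b|a b c|a|a|a b|a b|a].
- intros y _ Ha z Hyz _; exact (truth_upset a y z Hyz Ha).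
- intros y _ H1 z Hyz H2 w Hzw Ha.
  exact (H1 w (T _ _ _ Hyz Hzw) Ha w (R w) (H2 w Hzw Ha)).
- intros y _ Ha; left; exact Ha.
- intros y _ Hb; right; exact Hb.
- intros y _ H1 z Hyz H2 w Hzw [Ha|Hb].
  + exact (H1 w (T _ _ _ Hyz Hzw) Ha).
  + exact (H2 w Hzw Hb).
- intros y _ [Ha _]; exact Ha.
- intros y _ [_ Hb]; exact Hb.
- intros y _ H1 z Hyz H2 w Hzw Ha; split.
  + exact (H1 w (T _ _ _ Hyz Hzw) Ha).
  + exact (H2 w Hzw Ha).
- intros y _ _; exact I.
- intros y _ [].
- intros y _ H1 z Hyz H2 w Hzw Ha.
  exact (H2 w Hzw Ha w (R w) (H1 w (T _ _ _ Hyz Hzw) Ha)).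
- intros y _ H1 z Hyz Ha; destruct (H1 z Hyz Ha).
- split; intros y _ H z Hyz Ha.
  + apply truth_notnot_sim_top; exact (H z Hyz Ha).
  + apply truth_notnot_sim_top; exact (H z Hyz Ha).
Qed.

(** If [a] held at some [y] above [x] outside [Y0], then [x] would be outside [Y0] too, so the
    identity condition would put [y] below [x] and persistence would carry [a] back to [x]. *)
Lemma em_sim_sound (Hid : sub_normal_identity_frame F) (a : formula V)
  (x : world F) : truth F v x (a ∨ ∼ a).
Proof.
destruct (classic (truth F v x a)) as [Ha|Hna]; [left; exact Ha|right].
intros y Hxy Ha; apply NNPP; intros Hy; apply Hna.
refine (truth_upset a y x _ Ha).
apply (sni_identity Hid); [|assumption..].
intros Hx; apply Hy; exact (sn_upset HF x y Hxy Hx).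
Qed.

Lemma derivable_sound (Ax : formula V -> Prop) :
  (forall a, Ax a -> forall x, truth F v x a) ->
  forall a, derivable Ax a -> forall x, truth F v x a.
Proof.
intros HAx a D; induction D as [a Ha|a b _ IH1 _ IH2]; intros x; [auto|].
exact (IH1 x x (le_refl x) (IH2 x)).
Qed.

End Soundness.

(** * Theories over any axiom set that includes the ILM axioms, and their prime extensions *)

Section Completeness.

Variable V : Type.
Variable Ax : formula V -> Prop.
Hypothesis ILM_Ax : forall a, ILM_axiom a -> Ax a.

Record theory (T : formula V -> Prop) : Prop := {
  theory_ax : forall a, Ax a -> T a;
  theory_mp : forall a b, T (a ⇒ b) -> T a -> T b
}.

Definition prime (T : formula V -> Prop) : Prop :=
  forall a b, T (a ∨ b) -> T a \/ T b.

Lemma theory_derivable : theory (derivable Ax).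
Proof. split; [exact (@D_ax V Ax)|exact (@D_mp V Ax)]. Qed.

Section Theory.

Variable T : formula V -> Prop.
Hypothesis HT : theory T.

Lemma theory_ILM (a : formula V) : ILM_axiom a -> T a.
Proof. intros H; apply (theory_ax _ HT), ILM_Ax, H. Qed.

Lemma theory_ILM1 (a b : formula V) : ILM_axiom (a ⇒ b) -> T a -> T b.
Proof. intros H; exact (theory_mp _ HT _ _ (theory_ILM _ H)). Qed.

Lemma theory_ILM2 (a b c : formula V) :
  ILM_axiom (a ⇒ (b ⇒ c)) -> T a -> T b -> T c.
Proof. intros H Ha; exact (theory_mp _ HT _ _ (theory_ILM1 _ _ H Ha)). Qed.

Lemma theory_imp_const (a b : formula V) : T b -> T (a ⇒ b).
Proof. apply theory_ILM1, A1. Qed.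

Lemma theory_imp_refl (a : formula V) : T (a ⇒ a).
Proof.
apply (theory_ILM2 _ _ _ (A2 a (a ⇒ a) a)); apply theory_ILM, A1.
Qed.

Lemma theory_top : T ⊤.
Proof. exact (theory_ILM1 _ _ (A7 _) (theory_imp_refl ⊤)). Qed.

Lemma theory_and (a b : formula V) : T (a ∧ b) <-> T a /\ T b.
Proof.
split.
- intros H; split; revert H; apply theory_ILM1; constructor.
(* A6 forms conjunctions only under an antecedent; [⊤] serves as one and is then discharged. *)
- intros [Ha Hb]; apply (theory_mp _ HT ⊤); [|exact theory_top].
  apply (theory_ILM2 _ _ _ (A6 ⊤ a b)); apply theory_imp_const; assumption.
Qed.

Lemma theory_sim (a : formula V) : T (∼ a) <-> T (a ⇒ ¬ ¬ ∼ ⊤).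
Proof.
destruct (proj1 (theory_and _ _) (theory_ILM _ (A11 a))) as [H1 H2].
split; apply (theory_mp _ HT); assumption.
Qed.

(** Reduces negation to implication for [mem_neg]. For the converse, A8 turns [a ⇒ ⊥] into
    [a ⇒ ¬ a], and A9 combines this with [a ⇒ a]. *)
Lemma theory_neg (a : formula V) : T (¬ a) <-> T (a ⇒ ⊥).
Proof.
split; [apply theory_ILM1, A10|intros H].
apply (theory_ILM2 _ _ _ (A9 a a)); [apply theory_imp_refl|].
apply (theory_ILM2 _ _ _ (A2 a ⊥ (¬ a))); [|exact H].
apply theory_imp_const, theory_ILM, A8.
Qed.

(** This is the theory generated by [T] and [a], with the deduction theorem built in; A1 and A2 give
    the closure. *)
Lemma theory_adjoin (a : formula V) : theory (fun b => T (a ⇒ b)).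
Proof.
split.
- intros b Hb; apply theory_imp_const, (theory_ax _ HT), Hb.
- intros b c; apply theory_ILM2, A2.
Qed.

End Theory.

(* Zorn's lemma on the theories that extend [T] and avoid [c]: if [a ∨ b] lies
   in a maximal one, [M], but [a] and [b] do not, then the theories obtained by
   adjoining [a] and [b] both contain [c], so [A4] puts [c] into [M].  Zorn is
   applied to the sets [A] for which [T ∪ A] is such a theory, so that the
   union of the empty chain qualifies too. *)
Lemma prime_extension (T : formula V -> Prop) (c : formula V) :
  theory T -> ~ T c ->
  exists M, theory M /\ prime M /\ (forall a, T a -> M a) /\ ~ M c.
Proof.
intros HT Tc.
pose (P := fun A : formula V -> Prop =>
  theory (fun a => T a \/ A a) /\ ~ (T c \/ A c)).
destruct (@classical_sets.Zorn_bigcup (formula V) P) as [A [[HM Mc] Hmax]].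
- intros S SP Stot; split; [split|].
  + intros a Ha; left; exact (theory_ax _ HT a Ha).
  + assert (mp : forall A a b, S A -> T (a ⇒ b) \/ A (a ⇒ b) -> T a \/ A a ->
      T b \/ exists2 X, S X & X b).
    { intros A a b SA Hab Ha.
      destruct (theory_mp _ (proj1 (SP A SA)) a b Hab Ha); eauto. }
    intros a b [Tab|[A SA Aab]] [Ta|[B SB Ba]]; eauto.
    * left; exact (theory_mp _ HT a b Tab Ta).
    * destruct (Stot A B SA SB) as [H|H]; eauto.
  + intros [H|[A SA Ac]]; [auto|]; destruct (SP A SA); auto.
- pose (M := fun a => T a \/ A a); change (theory M) in HM; change (~ M c) in Mc.
  assert (adjoin : forall a, ~ M a -> M (a ⇒ c)).
  { intros a Ma; apply NNPP; intros Mac.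
    assert (MB : forall b, M b -> M (a ⇒ b)) by exact (theory_imp_const _ HM a).
    apply (Hmax (fun b => M (a ⇒ b))); [split|split; [split|]].
    - intros b Ab; apply MB; right; exact Ab.
    - intros H; apply Ma; right; apply H, (theory_imp_refl _ HM).
    - intros b Hb; left; exact (theory_ax _ HT b Hb).
    - assert (TB : forall b, T b \/ M (a ⇒ b) -> M (a ⇒ b)).
      { intros b [Tb|Hb]; [apply MB; left|]; assumption. }
      intros b d Hbd Hb; right.
      exact (theory_mp _ (theory_adjoin _ HM a) b d (TB _ Hbd) (TB _ Hb)).
    - tauto. }
  exists M; split; [exact HM|split; [|split; [|exact Mc]]].
  + intros a b Mab; apply NNPP; intros H; apply Mc.
    refine (theory_mp _ HM _ _ (theory_ILM2 _ HM _ _ _ (A4 a b c) _ _) Mab);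
      apply adjoin; tauto.
  + intros a Ta; left; exact Ta.
Qed.

(** * The canonical frame and completeness *)

Definition canonical_world : Type :=
  { T : formula V -> Prop | theory T /\ prime T /\ ~ T ⊥ }.

Definition mem (x : canonical_world) : formula V -> Prop := proj1_sig x.

Definition canonical_frame : frame :=
  Frame (fun x y : canonical_world => forall a, mem x a -> mem y a)
        (fun x => mem x (¬ ¬ ∼ ⊤)).

Definition canonical_valuation (p : V) (x : world canonical_frame) : Prop :=
  mem x (Var p).

Lemma mem_theory (x : canonical_world) : theory (mem x).
Proof. exact (proj1 (proj2_sig x)). Qed.

Lemma mem_bot (x : canonical_world) : ~ mem x ⊥.
Proof. exact (proj2 (proj2 (proj2_sig x))). Qed.

Lemma mem_or (x : canonical_world) (a b : formula V) :
  mem x (a ∨ b) <-> mem x a \/ mem x b.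
Proof.
split.
- exact (proj1 (proj2 (proj2_sig x)) a b).
- intros [H|H]; revert H; apply (theory_ILM1 _ (mem_theory x)); constructor.
Qed.

(** A theory that avoids [c] is consistent, since A8 derives everything from [⊥]; so the prime
    extension is a world. *)
Lemma canonical_extension (T : formula V -> Prop) (c : formula V) :
  theory T -> ~ T c ->
  exists x : canonical_world, (forall a, T a -> mem x a) /\ ~ mem x c.
Proof.
intros HT Tc; destruct (prime_extension T c HT Tc) as [M [HM [PM [TM Mc]]]].
assert (Mbot : ~ M ⊥).
{ intros H; apply Mc; exact (theory_ILM1 _ HM _ _ (A8 c) H). }
exists (exist _ M (conj HM (conj PM Mbot))); split; assumption.
Qed.

(** If [a ⇒ b] is not in [x], the theory adjoining [a] to [x] avoids [b], and a world that extends
    it and still avoids [b] refutes the right-hand side. *)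
Lemma mem_imp (x : canonical_world) (a b : formula V) :
  mem x (a ⇒ b) <->
  forall y : canonical_world, le canonical_frame x y -> mem y a -> mem y b.
Proof.
split.
- intros H y Hxy; exact (theory_mp _ (mem_theory y) _ _ (Hxy _ H)).
- intros H; apply NNPP; intros Hab.
  pose proof (mem_theory x) as HT.
  destruct (canonical_extension _ b (theory_adjoin _ HT a) Hab) as [y [Hy Hb]].
  apply Hb, H.
  + intros c Hc; apply Hy, (theory_imp_const _ HT), Hc.
  + apply Hy, (theory_imp_refl _ HT).
Qed.

Lemma mem_neg (x : canonical_world) (a : formula V) :
  mem x (¬ a) <->
  forall y : canonical_world, le canonical_frame x y -> ~ mem y a.
Proof.
rewrite (theory_neg _ (mem_theory x)), mem_imp.
split; intros H y Hxy Ha.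
- exact (mem_bot y (H y Hxy Ha)).
- destruct (H y Hxy Ha).
Qed.

Lemma canonical_truth (a : formula V) (x : world canonical_frame) :
  truth canonical_frame canonical_valuation x a <-> mem x a.
Proof.
revert x; induction a as [p| | |a IHa b IHb|a IHa b IHb|a IHa b IHb|a IHa|a IHa];
  intros x; simpl.
- reflexivity.
- split; [intros _; exact (theory_top _ (mem_theory x))|exact (fun _ => I)].
- split; [intros []|exact (mem_bot x)].
- rewrite IHa, IHb; symmetry; exact (theory_and _ (mem_theory x) a b).
- rewrite IHa, IHb; symmetry; exact (mem_or x a b).
- rewrite mem_imp; split; intros H y Hxy Ha; apply IHb, (H y Hxy), IHa, Ha.
- rewrite mem_neg; split; intros H y Hxy Ha; apply (H y Hxy), IHa, Ha.
(* By A11 [∼ a] amounts to an implication into [¬ ¬ ∼ ⊤], whose membership defines [Y0]. *)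
- rewrite (theory_sim _ (mem_theory x)), mem_imp.
  split; intros H y Hxy Ha; apply (H y Hxy), IHa, Ha.
Qed.

(** Nonemptiness is assumed because there are no worlds when [Ax] derives [⊥]; in
    [canonical_complete] the refuting world supplies it. *)
Lemma canonical_sub_normal :
  inhabited canonical_world -> sub_normal_frame canonical_frame.
Proof.
intros Hinh; split; [exact Hinh|split| |].
- intros x a H; exact H.
- intros x y z H1 H2 a H; exact (H2 a (H1 a H)).
- intros [M HM] [N HN] H1 H2.
  assert (E : M = N).
  { apply functional_extensionality; intros a; apply propositional_extensionality.
    split; [exact (H1 a)|exact (H2 a)]. }
  subst N; f_equal; apply proof_irrelevance.
- intros x y Hxy; exact (Hxy _).
(* Regularity: if some [y] above [x] contained [¬ ∼ ⊤], a world of [Y0] above [y] would contain both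
   this and its negation. *)
- intros x H; apply mem_neg; intros y Hxy Hy.
  destruct (H y Hxy) as [z [Hyz Hz]].
  exact (proj1 (mem_neg z _) Hz z (fun _ H => H) (Hyz _ Hy)).
Qed.

Lemma canonical_identity :
  (forall a, Ax (a ∨ ∼ a)) -> inhabited canonical_world ->
  sub_normal_identity_frame canonical_frame.
Proof.
intros Hem Hinh; split; [exact (canonical_sub_normal Hinh)|].
intros x y _ Hy Hxy a Ha.
destruct (proj1 (mem_or x _ _) (theory_ax _ (mem_theory x) _ (Hem a)))
  as [H|H]; [exact H|].
destruct Hy; apply Hxy, (theory_sim _ (mem_theory y)) in H.
exact (theory_mp _ (mem_theory y) _ _ H Ha).
Qed.

(** An underivable [a] is avoided by the theory [derivable Ax], hence by some world, where it is
    false by [canonical_truth]. *)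
Lemma canonical_complete (C : frame -> Prop) (a : formula V) :
  (inhabited canonical_world -> C canonical_frame) ->
  class_valid C a -> derivable Ax a.
Proof.
intros HC Hval; apply NNPP; intros Hn.
destruct (canonical_extension _ a theory_derivable Hn) as [x [_ Hx]].
apply Hx, canonical_truth, (Hval _ (HC (inhabits x))).
intros p y z Hyz; exact (Hyz _).
Qed.

End Completeness.

Theorem corollary5p8 (V : Type) (a : formula V) :
  (ILM_provable a <-> class_valid sub_normal_frame a) /\
  (ILMv_provable a <-> class_valid sub_normal_identity_frame a).
Proof.
split; split.
- intros D F HF v Hv; revert a D; apply (derivable_sound _ _ HF).
  exact (ILM_axiom_sound _ _ HF v Hv).
- apply canonical_complete; [auto|].
  apply canonical_sub_normal; auto.
- intros D F HF v Hv; pose proof (sni_sub_normal HF) as HF'.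
  revert a D; apply (derivable_sound _ _ HF').
  intros a [b Hb|b].
  + exact (ILM_axiom_sound _ _ HF' v Hv b Hb).
  + exact (em_sim_sound _ _ HF' v Hv HF b).
- apply canonical_complete; [exact (@ILMv_ILM V)|].
  apply canonical_identity; [exact (@ILMv_ILM V)|exact (@ILMv_em V)].
Qed.
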